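(* Let $G$ be a graph with two distinct vertices $x, y\in V(G)$ such that $G+xy$ is 2-connected. Suppose that every vertex of $G$ other than $x$ and $y$ has degree at least $3$ in $G$, and that every edge $uv\in E(G)$ with $\{u,v\}\cap \{x,y\} = \emptyset$ has degree sum $d_G(u)+d_G(v)\ge 7$. Then there exist two paths from $x$ to $y$ in $G-xy$ whose lengths differ by two.
   Context: All graphs are finite, undirected and simple. $d_G(v)$ denotes the degree of $v$ in $G$. For two distinct vertices $x,y$ of $G$, $G+xy$ denotes the graph obtained from $G$ by adding the edge $xy$ (so $G+xy=G$ if $xy\in E(G)$), and $G-xy$ denotes the graph obtained from $G$ by removing the edge $xy$ (so $G-xy=G$ if $xy\notin E(G)$). The length of a path is its number of edges. *)

(* Defs.v *)
From mathcomp Require Import all_boot.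

Set Implicit Arguments.
Unset Strict Implicit.
Unset Printing Implicit Defensive.

(* Finite, undirected, simple graphs with vertex set V. *)
Record sgraph (V : finType) := SGraph {
  adj :> rel V;
  adj_sym : symmetric adj;
  adj_irr : irreflexive adj
}.

Definition degree (V : finType) (G : sgraph V) (v : V) : nat :=
  #|[set u | G v u]|.

Section EdgeOperations.
Variables (V : finType) (G : sgraph V) (x y : V).

(* The conjunct u != v only matters when x = y, where it prevents a loop. *)
Definition add_edge_rel : rel V :=
  fun u v => G u v || (u != v) && ([set u; v] == [set x; y]).

Lemma add_edge_sym : symmetric add_edge_rel.
Proof. by move=> u v; rewrite /add_edge_rel adj_sym eq_sym setUC. Qed.

Lemma add_edge_irr : irreflexive add_edge_rel.
Proof. by move=> u; rewrite /add_edge_rel adj_irr eqxx. Qed.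

Definition add_edge : sgraph V := SGraph add_edge_sym add_edge_irr.

Definition del_edge_rel : rel V :=
  fun u v => G u v && ([set u; v] != [set x; y]).

Lemma del_edge_sym : symmetric del_edge_rel.
Proof. by move=> u v; rewrite /del_edge_rel adj_sym setUC. Qed.

Lemma del_edge_irr : irreflexive del_edge_rel.
Proof. by move=> u; rewrite /del_edge_rel adj_irr. Qed.

Definition del_edge : sgraph V := SGraph del_edge_sym del_edge_irr.

End EdgeOperations.

Definition induced_rel (V : finType) (G : sgraph V) (S : {set V}) : rel V :=
  fun u v => [&& u \in S, v \in S & G u v].

(* The subgraph of G induced by S is connected (the empty graph is not). *)
Definition connected_on (V : finType) (G : sgraph V) (S : {set V}) : Prop :=
  S != set0 /\ {in S &, forall u v, connect (induced_rel G S) u v}.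

Definition k_connected (k : nat) (V : finType) (G : sgraph V) : Prop :=
  k < #|V| /\ (forall X : {set V}, #|X| < k -> connected_on G (~: X)).

(* The path with vertex sequence x :: p, without repeated vertices; its length
   (number of edges) is size p. *)
Definition is_path (V : finType) (G : sgraph V) (x y : V) (p : seq V) : Prop :=
  [/\ path G x p, last x p = y & uniq (x :: p)].

(* Main.v *)
Require Import Defs.
From mathcomp Require Import all_boot.
From mathcomp Require Import zify.

Set Implicit Arguments.
Unset Strict Implicit.
Unset Printing Implicit Defensive.

(** The proof is an induction that alternately cuts the graph along a small
    separator and contracts the neighbourhood of one end.  To avoid building
    quotient graphs, the graph [G] stays fixed and a rooted piece is described
    by three vertex sets: [A] and [B] stand for two vertices obtained by
    contracting them, and [D] is the interior.  A [link] is the interior of a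
    path between the contracted vertices, and the record [rooted] says that
    this contracted graph, with an edge added between its two ends, is
    2-connected and that contracting costs no vertex of [D] any degree.  The
    theorem is the piece [({x}, {y}, V - {x, y})], and [rooted_two_links] finds
    two links whose sizes differ by two by induction on the size of [D].  Write
    [A'] and [B'] for the neighbours in [D] of [A] and of [B].

    If some [v] in [D] separates a part [K] of [D] from [B], then [(A, {v}, K)]
    is again a rooted piece, and its links are prolonged by a common path from
    [v] to [B] ([separation_step]).  So assume that there is no such separation,
    at either end.

    If some [v] in [D] has two neighbours [a], [b] in [A'], then there is a path
    from [a], say, to [B] which avoids [v] and [b]; starting it as [a ...] or as
    [b v a ...] gives sizes that differ by two ([four_cycle_step]).  So assume
    that no vertex of [D] has two neighbours in [A'], nor two in [B'].  Then
    contracting [A'] costs no degree, and [A'] can replace [A]: every link loses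
    its first vertex ([contraction_step]).  This requires an interior, that is,
    a neighbour of [B] outside [A'].

    Otherwise, applying this to both ends, [A'] and [B'] are the same set [N].
    This is where the degree sum matters: if [N] were all of [D], then [N] would
    induce a matching, each vertex would have degree at most 3, and an edge
    would have degree sum at most 6 ([boundary_outside]); the complete graph on
    four vertices is of this kind.  So some [a] in [N] has a neighbour outside
    [N], and the links from [a] to the rest of [N] through [D - N] finish the
    proof ([common_boundary_step]). *)

(** * Leaving a set of vertices *)
Section RootedPieces.
Variables (V : finType) (G : sgraph V).
Implicit Types (A B D K O R S W : {set V}) (T : pred V) (s t p : seq V).

(** Connectivity is expressed through neighbours: no part [K] of the interior
    has its neighbours outside [K] confined to the obstacle [O].  In this form it
    passes from an interior to its subsets without any path surgery. *)
Definition exits K O : bool :=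
  [exists u in K, exists w, [&& G u w, w \notin K & w \notin O]].

Lemma exitsP K O :
  reflect (exists u w, [/\ u \in K, G u w, w \notin K & w \notin O])
          (exits K O).
Proof.
apply: (iffP exists_inP) => [[u uK /existsP[w /and3P[? ? ?]]]|].
  by exists u, w.
move=> [u [w [uK Guw wK wO]]]; exists u => //.
by apply/existsP; exists w; rewrite Guw wK.
Qed.

(** If no path works, [K] can be taken to be the component of [z] in the graph
    induced by [S]; callers contradict it by leaving [K]. *)
Lemma path_or_closed S z T : z \in S ->
  (exists p, [/\ path G z p, uniq (z :: p), {subset z :: p <= S}
               & T (last z p)]) \/
  (exists K, [/\ z \in K, K \subset S, {in K, forall u, ~~ T u}
               & forall u w, u \in K -> w \in S -> G u w -> w \in K]).
Proof.
move=> zS; pose e := induced_rel G S.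
have pathS p : path e z p -> path G z p /\ {subset z :: p <= S}.
  elim: p z zS => [|w p IHp] z zS /=.
    by split=> // c; rewrite inE => /eqP->.
  case/andP=> /and3P[_ wS Gzw] /(IHp w wS)[Gp pS]; split; first by rewrite Gzw.
  by move=> c; rewrite inE => /predU1P[->|/pS].
pose K := [set w | connect e z w].
case: (boolP [exists u in K, T u]) => [/exists_inP[u]|noT].
  rewrite inE => /connectP[p ep ->] Tu; left.
  case/shortenP: ep Tu => q eq uq _ Tu.
  by have [Gq qS] := pathS q eq; exists q.
right; exists K; split.
- by rewrite inE connect0.
- apply/subsetP=> w; rewrite inE => /connectP[p ep ->].
  by have [_ ->] := pathS p ep; rewrite ?mem_last.
- by move=> u uK; apply: contra noT => Tu; apply/exists_inP; exists u.
move=> u w; rewrite !inE => zu wS Guw; apply: connect_trans (zu) (connect1 _).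
rewrite /e /induced_rel wS Guw !andbT.
by case/connectP: zu => p ep ->; have [_ ->] := pathS p ep; rewrite ?mem_last.
Qed.

(** Deleting [A'] from the interior may leave components that no longer touch
    the other end; the interior of the new piece must be the union [R] of those
    components of [W] which meet the target [T].  It is built as the least
    subset of [W] that contains its target vertices and is closed under
    adjacency: if [K] could not be left towards [T] or [R - K], then [R - K]
    would be smaller. *)
Lemma attached_part W T : exists R,
  [/\ R \subset W,
      forall w, w \in W -> T w -> w \in R,
      forall u w, u \in R -> w \in W -> G u w -> w \in R
    & forall K, K \subset R -> K != set0 ->
        exists2 u, u \in K & T u \/ exists2 w, w \in R :\: K & G u w].
Proof.
pose closedW := [pred R : {set V} | (R \subset W)
  && [forall w in W, T w ==> (w \in R)]
  && [forall u in R, forall w in W, G u w ==> (w \in R)]].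
have cW : closedW W.
  rewrite /= subxx /=; apply/andP; split.
    by apply/forall_inP=> w ->; rewrite implybT.
  by apply/forall_inP=> u _; apply/forall_inP=> w ->; rewrite implybT.
have [R /minsetP[/andP[/andP[RW /forall_inP Ra] /forall_inP Rc] Rmin] _] :=
  minset_exists cW.
have Rc' u w : u \in R -> w \in W -> G u w -> w \in R.
  by move=> uR wW Guw; move/forall_inP: (Rc u uR) => /(_ w wW); rewrite Guw.
exists R; split=> // [w wW Tw|K KR /set0Pn[k kK]].
  by move: (Ra w wW); rewrite Tw.
case: (boolP [exists u in K, T u || [exists w in R :\: K, G u w]]).
  case/exists_inP=> u uK /orP[Tu|/exists_inP[w wRK Guw]].
    by exists u => //; left.
  by exists u => //; right; exists w.
move=> noexit; have stay u : u \in K ->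
  ~~ T u /\ (forall w, w \in R :\: K -> ~~ G u w).
  move=> uK; move: noexit; rewrite negb_exists_in => /forall_inP/(_ u uK).
  by rewrite negb_or negb_exists_in => /andP[-> /forall_inP].
exfalso; suff eR : R :\: K = R by move/setP/(_ k): eR; rewrite !inE kK (subsetP KR).
apply: Rmin (subsetDl _ _).
rewrite /= (subset_trans (subsetDl _ _) RW) /=; apply/andP; split.
  apply/forall_inP=> w wW; apply/implyP=> Tw; rewrite inE.
  move: (Ra w wW); rewrite Tw /= => ->; rewrite andbT.
  by apply: contraL Tw => /stay[].
apply/forall_inP=> u uRK; apply/forall_inP=> w wW; apply/implyP=> Guw.
have uR : u \in R by case/setDP: uRK.
rewrite inE (Rc' u w) // andbT; apply/negP=> /stay[_ /(_ u uRK)].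
by rewrite adj_sym Guw.
Qed.

(** * Links and rooted pieces *)

(** The ends in [A] and [B] are not part of the sequence: after contraction
    they are a single vertex, and only the interior has to be simple. *)
Definition link A B D s : Prop :=
  [/\ s != [::], uniq s, {subset s <= D}
    & exists a b, [/\ a \in A, b \in B & path G a (rcons s b)]].

Definition two_links A B D : Prop :=
  exists s t, [/\ link A B D s, link A B D t & size t = size s + 2].

Lemma link_sym A B D s : link A B D s -> link B A D (rev s).
Proof.
move=> [s0 us sD [a [b [aA bB pab]]]]; split.
- by rewrite -size_eq0 size_rev size_eq0.
- by rewrite rev_uniq.
- by move=> w; rewrite mem_rev => /sD.
exists b, a; split=> //.
have := rev_path G a (rcons s b); rewrite last_rcons belast_rcons rev_cons => ->.
by apply: sub_path pab => u w; rewrite adj_sym.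
Qed.

Lemma two_links_sym A B D : two_links A B D -> two_links B A D.
Proof.
move=> [s [t [ls lt st]]]; exists (rev s), (rev t).
by rewrite !size_rev; split=> //; apply: link_sym.
Qed.

(** The fields [rooted_exitl], [rooted_exitr] and [rooted_exit1] say that
    contracting [A] and [B] and joining the two resulting vertices by an edge
    gives a 2-connected graph: they are the deletion of the first, of the second
    and of any other vertex.  By [rooted_onel] and [rooted_oner] the contraction
    merges no two edges at a vertex of [D], so the degree conditions may refer
    to degrees in [G]. *)
Record rooted A B D : Prop := Rooted {
  rooted_n0 : D != set0;
  rooted_disjl : [disjoint A & D];
  rooted_disjr : [disjoint B & D];
  rooted_nbr : forall v w, v \in D -> G v w -> [|| w \in A, w \in B | w \in D];
  rooted_onel : forall v, v \in D -> #|[set w in A | G v w]| <= 1;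
  rooted_oner : forall v, v \in D -> #|[set w in B | G v w]| <= 1;
  rooted_exitl : forall K, K \subset D -> K != set0 -> exits K A;
  rooted_exitr : forall K, K \subset D -> K != set0 -> exits K B;
  rooted_exit1 : forall K d, K \subset D -> K != set0 -> d \notin K ->
    exits K [set d];
  rooted_deg : forall v, v \in D -> 3 <= degree G v;
  rooted_sum : forall u v, u \in D -> v \in D -> G u v ->
    7 <= degree G u + degree G v
}.

Lemma rooted_sym A B D : rooted A B D -> rooted B A D.
Proof.
case=> D0 dA dB nb oA oB eA eB e1 dg sm; split=> // v w vD Gvw.
by rewrite orbCA; apply: (nb v).
Qed.

Lemma at_most_one_nbr (X : {set V}) v u w : #|[set z in X | G v z]| <= 1 ->
  u \in X -> w \in X -> G v u -> G v w -> u = w.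
Proof.
by move=> /card_le1_eqP c uX wX Gu Gw; apply: c; rewrite inE ?uX ?wX.
Qed.

Lemma one_nbr_set1 v a : #|[set z in [set a] | G v z]| <= 1.
Proof.
rewrite -(cards1 a); apply/subset_leq_card/subsetP=> z.
by rewrite inE => /andP[].
Qed.

(** * Separations by one interior vertex *)

(** The piece [(A, {v}, K)] satisfies the conditions for [rooted] because
    leaving a part of [K] while avoiding [v] leads into [A] or the rest of [K].
    All its links are prolonged by the same path from [v] to [B] outside [K],
    which exists since otherwise [K] together with everything reachable from
    [v] could only be left through [A]. *)
Lemma separation_step A B D v K : rooted A B D ->
    (forall A' B' D', #|D'| < #|D| -> rooted A' B' D' -> two_links A' B' D') ->
    v \in D -> K \subset D -> K != set0 -> v \notin K ->
    ~~ exits K (v |: A) ->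
  two_links A B D.
Proof.
move=> rD IH vD KD K0 vK nex.
have stay u w : u \in K -> G u w -> [|| w == v, w \in A | w \in K].
  move=> uK Guw; apply: contraR nex; rewrite !negb_or => /and3P[wv wA wK].
  by apply/exitsP; exists u, w; split=> //; rewrite !inE negb_or wv.
have [s [t [ls lt st]]] : two_links A [set v] K.
  apply: IH; first by apply: proper_card; apply/properP; split=> //; exists v.
  have inD u : u \in K -> u \in D by apply: (subsetP KD).
  split=> //.
  - by apply: disjointWr KD (rooted_disjl rD).
  - by rewrite disjoints1.
  - by move=> u w uK /(stay u w uK); rewrite inE orbCA.
  - by move=> u /inD; apply: rooted_onel rD _.
  - by move=> u _; apply: one_nbr_set1.
  - by move=> L LK; apply: (rooted_exitl rD); apply: subset_trans KD.
  - move=> L LK L0; apply: (rooted_exit1 rD) => //; first exact: subset_trans KD.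
    by apply: contra vK; apply: (subsetP LK).
  - by move=> L d LK; apply: (rooted_exit1 rD); apply: subset_trans KD.
  - by move=> u /inD; apply: rooted_deg rD _.
  by move=> u w /inD uD /inD wD; apply: rooted_sum rD _ _ uD wD.
pose T u := [exists b in B, G u b].
have vDK : v \in D :\: K by rewrite inE vK.
have [[p [Gp up pDK /exists_inP[b bB Gb]]]|[L [vL LDK nT cL]]] :=
  path_or_closed T vDK; last first.
  have LK_D : L :|: K \subset D.
    by rewrite subUset KD (subset_trans LDK (subsetDl _ _)).
  have : exits (L :|: K) A.
    by apply: (rooted_exitl rD) => //; apply/set0Pn; exists v; rewrite inE vL.
  case/exitsP=> u [w [uLK Guw wLK wA]]; exfalso.
  move: wLK; rewrite inE negb_or => /andP[wL wK].
  case/setUP: uLK => [uL|uK]; last first.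
    move: (stay u w uK Guw); rewrite (negPf wA) (negPf wK) !orbF => /eqP ewv.
    by rewrite ewv vL in wL.
  have uD : u \in D by rewrite (subsetP LK_D) // inE uL.
  move: (rooted_nbr rD uD Guw); rewrite (negPf wA) /= => /orP[wB|wD].
    by move/negP: (nT u uL); apply; apply/exists_inP; exists w.
  by rewrite (cL u w) // inE wK in wL.
(* The last vertex [v] of the path closing the link [q] becomes interior. *)
have ext q : link A [set v] K q -> link A B D (q ++ v :: p).
  move=> [q0 uq qK [a [c [aA /set1P-> pq]]]]; split.
  - by rewrite -size_eq0 size_cat addnS.
  - rewrite cat_uniq uq up andbT andTb; apply/hasPn=> z /pDK.
    by case/setDP=> _; apply: contra => /qK.
  - move=> z; rewrite mem_cat => /orP[/qK/(subsetP KD)//|/pDK].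
    by case/setDP.
  exists a, b; split=> //.
  by rewrite rcons_cat rcons_cons -cat_rcons cat_path pq last_rcons rcons_path Gp.
exists (s ++ v :: p), (t ++ v :: p); split; try exact: ext.
by rewrite !size_cat st addnAC.
Qed.

(** No vertex and part of [D] satisfy the hypotheses of [separation_step]. *)
Definition unseparated A D : bool :=
  [forall v in D, forall K : {set V},
     (K \subset D) && (K != set0) && (v \notin K) ==> exits K (v |: A)].

Definition boundary A D : {set V} := [set v in D | [exists a in A, G a v]].

Lemma boundaryP A D v :
  reflect (v \in D /\ exists2 a, a \in A & G a v) (v \in boundary A D).
Proof.
rewrite inE; apply: (iffP andP) => [[? /exists_inP]|[? ?]] //.
by split=> //; apply/exists_inP.
Qed.

(** * Two neighbours in the boundary *)

(** Contracting [A] turns [a], [v], [b] into a 4-cycle through the new vertex,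
    so that [a] is reached with nothing before it or with [b] and [v] before it.
    What remains is a path from [a] to [B] avoiding [b] and [v], or the same
    with [a] and [b] exchanged. *)
Lemma four_cycle_step A B D v a b : rooted A B D -> unseparated A D ->
    v \in D -> a \in boundary A D -> b \in boundary A D -> a != b ->
    G v a -> G v b ->
  two_links A B D.
Proof.
move=> rD /forall_inP tD vD.
wlog [p [Gp up pS Tp]] : a b / exists p,
    [/\ path G a p, uniq (a :: p), {subset a :: p <= D :\ v :\ b}
      & [exists c in B, G (last a p) c]].
  move=> wlogH aA bA ab Gva Gvb.
  have inS c d : c \in boundary A D -> c != d -> G v c -> c \in D :\ v :\ d.
    move=> /boundaryP[cD _] cd Gvc; rewrite !inE cd cD andbT.
    by apply: contraTneq Gvc => ->; rewrite adj_irr.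
  pose T u := [exists c in B, G u c].
  have ba : b != a by rewrite eq_sym.
  have [ha|[K [aK KS KT cK]]] := path_or_closed T (inS a b aA ab Gva).
    exact: (wlogH a b).
  have [hb|[L [bL LS LT cL]]] := path_or_closed T (inS b a bA ba Gvb).
    exact: (wlogH b a).
  (* With neither path, the components [K] of [a] and [L] of [b] together are
     separated from [B] by [v]. *)
  exfalso; move/forallP: (tD v vD) => /(_ (K :|: L)).
  have KL_D : K :|: L \subset D.
    rewrite subUset (subset_trans KS) ?(subset_trans LS) //;
    by rewrite (subset_trans (subsetDl _ _)) ?subsetDl.
  have vKL : v \notin K :|: L.
    apply/negP=> /setUP[/(subsetP KS)|/(subsetP LS)];
    by rewrite !inE eqxx andbF.
  rewrite KL_D vKL; have -> : K :|: L != set0.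
    by apply/set0Pn; exists a; rewrite inE aK.
  move=> /exitsP[u [w [uKL Guw wKL]]]; rewrite !inE negb_or => /andP[wv wA].
  move: wKL; rewrite inE negb_or => /andP[wK wL].
  move: (rooted_nbr rD (subsetP KL_D u uKL) Guw); rewrite (negPf wA) /=.
  case/orP=> [wB|wD]; case/setUP: uKL => uKL.
  - by move/negP: (KT u uKL); apply; apply/exists_inP; exists w.
  - by move/negP: (LT u uKL); apply; apply/exists_inP; exists w.
  - move/negP: wK; apply; apply: (cK u) => //; rewrite !inE wv wD andbT.
    by rewrite andbT; apply: contraNneq wL => ->.
  move/negP: wL; apply; apply: (cL u) => //; rewrite !inE wv wD andbT.
  by rewrite andbT; apply: contraNneq wK => ->.
move=> /boundaryP[aD [x xA Gxa]] /boundaryP[bD [y yA Gyb]] ab Gva Gvb.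
case/exists_inP: Tp => c cB Gc.
exists (a :: p), [:: b, v, a & p]; split; last by rewrite /= addn2.
- split=> //; first by move=> z /pS; rewrite !inE => /and3P[].
  by exists x, c; split=> //=; rewrite Gxa rcons_path Gp.
split=> //.
- have bv : b != v by apply: contraTneq Gvb => ->; rewrite adj_irr.
  rewrite 2!cons_uniq up andbT in_cons negb_or bv /=.
  by apply/andP; split; apply/negP=> /pS; rewrite !inE eqxx ?andbF.
- move=> z; rewrite 2!in_cons => /or3P[/eqP->//|/eqP->//|/pS].
  by rewrite !inE => /and3P[].
by exists y, c; split=> //=; rewrite Gyb adj_sym Gvb Gva rcons_path Gp.
Qed.

(** * Contracting the boundary *)

(** The new interior [R] consists of the parts of [D - A'] attached to [B].  Its
    vertices have no neighbour in [A], so their neighbours all lie in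
    [A'], [B] or [R]. A link from [A'] becomes one from [A] when its starting
    point in [A'] is added; the two starting points may be different. *)
Lemma contraction_step A B D : rooted A B D ->
    (forall A' B' D', #|D'| < #|D| -> rooted A' B' D' -> two_links A' B' D') ->
    (forall v, v \in D -> #|[set a in boundary A D | G v a]| <= 1) ->
    ~~ (boundary B D \subset boundary A D) ->
  two_links A B D.
Proof.
move=> rD IH one /subsetPn[w0 w0B w0A].
set N := boundary A D in one w0A *.
have ND : N \subset D by apply/subsetP=> z /boundaryP[].
have [R [RW Ra Rc Rex]] := attached_part (D :\: N) (fun u => [exists b in B, G b u]).
have RD : R \subset D := subset_trans RW (subsetDl _ _).
have w0R : w0 \in R.
  case/boundaryP: w0B => w0D [b bB Gb]; apply: Ra; first by rewrite inE w0A.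
  by apply/exists_inP; exists b.
have inD u : u \in R -> u \in D by apply: (subsetP RD).
have notN u : u \in R -> u \notin N by move/(subsetP RW)/setDP=> [].
have ltRD : #|R| < #|D|.
  have [u [w [uD Guw wD wB]]] := exitsP _ _ (rooted_exitr rD (subxx D) (rooted_n0 rD)).
  apply: proper_card; apply/properP; split=> //; exists u => //.
  have wA : w \in A.
    by move: (rooted_nbr rD uD Guw); rewrite (negPf wB) (negPf wD) !orbF.
  apply/negP=> /notN/negP; apply; apply/boundaryP; split=> //.
  by exists w => //; rewrite adj_sym.
have rR : rooted N B R.
  split.
  - by apply/set0Pn; exists w0.
  - by rewrite disjoint_sym disjoint_subset; apply/subsetP=> u /notN.
  - by apply: disjointWr RD (rooted_disjr rD).
  - move=> u w uR Guw; case: (boolP (w \in N)) => //= wN.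
    case/or3P: (rooted_nbr rD (inD u uR) Guw) => [wA|->//|wD].
      case/negP: (notN u uR); apply/boundaryP; split; first exact: inD.
      by exists w => //; rewrite adj_sym.
    by rewrite (Rc u w) ?orbT // inE wN.
  - by move=> u /inD; apply: one.
  - by move=> u /inD; apply: rooted_oner rD _.
  - move=> K KR K0; have [u uK [/exists_inP[b bB Gbu]|[w /setDP[wR wK] Guw]]] :=
      Rex K KR K0.
      have bD := disjointFr (rooted_disjr rD) bB.
      apply/exitsP; exists u, b; split=> //; first by rewrite adj_sym.
        by apply: contraFN bD => /(subsetP KR)/inD.
      by apply: contraFN bD => /(subsetP ND).
    by apply/exitsP; exists u, w; split=> //; apply: notN.
  - by move=> K KR; apply: rooted_exitr rD _ (subset_trans KR RD).
  - by move=> K d KR; apply: rooted_exit1 rD _ _ (subset_trans KR RD).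
  - by move=> u /inD; apply: rooted_deg rD _.
  by move=> u w /inD uD /inD wD; apply: rooted_sum rD _ _ uD wD.
have ext s : link N B R s -> exists2 a, a \in D & link A B D (a :: s).
  move=> [s0 us sR [a [b [aN bB pab]]]].
  have /boundaryP[aD [x xA Gxa]] := aN; exists a => //; split=> //.
  - by rewrite cons_uniq us andbT; apply/negP=> /sR/notN/negP.
  - by move=> z; rewrite inE => /predU1P[->//|/sR/inD].
  by exists x, b; split=> //=; rewrite Gxa.
have [s [t [/ext[a _ ls] /ext[c _ lt] st]]] := IH _ _ _ ltRD rR.
by exists (a :: s), (c :: t); split=> //=; rewrite st.
Qed.

(** * A common boundary *)

(** If [A'] were [D], a vertex would have at most one neighbour in each of
    [A], [B] and [D].  Having degree at least 3 it has a neighbour in [D], and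
    these two vertices violate the degree sum condition. *)
Lemma boundary_outside A B D : rooted A B D ->
    boundary B D = boundary A D ->
    (forall v, v \in D -> #|[set a in boundary A D | G v a]| <= 1) ->
  D :\: boundary A D != set0.
Proof.
move=> rD eN one; apply/negP=> /eqP; set N := boundary A D in one * => D0.
have DN v : v \in D -> v \in N.
  move=> vD; apply: contraT => vN; have : v \in D :\: N by rewrite inE vN.
  by rewrite D0 inE.
have degE v : v \in D -> degree G v <= 2 + #|[set a in N | G v a]|.
  move=> vD; rewrite /degree.
  have sub : [set u | G v u] \subset
    [set a in A | G v a] :|: [set a in B | G v a] :|: [set a in N | G v a].
    apply/subsetP=> w; rewrite !inE => Gvw; rewrite Gvw !andbT -orbA.
    case/or3P: (rooted_nbr rD vD Gvw) => [->//|->|wD]; first by rewrite orbT.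
    by move: (DN w wD); rewrite inE => ->; rewrite !orbT.
  apply: leq_trans (subset_leq_card sub) _.
  apply: leq_trans (leq_card_setU _ _).1 _; rewrite leq_add2r.
  apply: leq_trans (leq_card_setU _ _).1 _.
  exact: leq_add (rooted_onel rD vD) (rooted_oner rD vD).
have [v vD] := set0Pn _ (rooted_n0 rD).
have nbr : 0 < #|[set a in N | G v a]|.
  by have := degE v vD; have := rooted_deg rD vD; lia.
have /set0Pn[w] : [set a in N | G v a] != set0 by rewrite -card_gt0.
rewrite inE => /andP[/boundaryP[wD _] Gvw].
have := rooted_sum rD vD wD Gvw; have := degE v vD; have := degE w wD.
by have := one v vD; have := one w wD; lia.
Qed.

(** Splitting the common boundary [N] as [{a}] and [N - a] makes it serve as
    both ends, since every vertex of [N] has a neighbour in [A] and one in [B].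
    A part of [D - N] has a neighbour in [N] other than [a] because [a] alone
    does not separate it, and the neighbour [a] itself is guaranteed by taking
    only the components that touch [a]. *)
Lemma common_boundary_step A B D : rooted A B D ->
    (forall A' B' D', #|D'| < #|D| -> rooted A' B' D' -> two_links A' B' D') ->
    boundary B D = boundary A D ->
    (forall v, v \in D -> #|[set a in boundary A D | G v a]| <= 1) ->
  two_links A B D.
Proof.
move=> rD IH eN one; have W0 := boundary_outside rD eN one.
set N := boundary A D in eN one W0.
have ND : N \subset D by apply/subsetP=> z /boundaryP[].
have WD : D :\: N \subset D := subsetDl _ _.
have nbrW v w : v \in D :\: N -> G v w -> (w \in N) || (w \in D :\: N).
  case/setDP=> vD vN Gvw; rewrite in_setD; case: (boolP (w \in N)) => //= _.
  case/or3P: (rooted_nbr rD vD Gvw) => // [wA|wB]; case/negP: vN.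
    by apply/boundaryP; split=> //; exists w => //; rewrite adj_sym.
  by rewrite -eN; apply/boundaryP; split=> //; exists w => //; rewrite adj_sym.
have [u [a [uW Gua aW _]]] := exitsP _ _ (rooted_exitl rD WD W0).
have aN : a \in N by move: (nbrW u a uW Gua); rewrite (negPf aW) orbF.
have [R [RW Ra Rc Rex]] := attached_part (D :\: N) (G a).
have RD : R \subset D := subset_trans RW WD.
have uR : u \in R by apply: Ra => //; rewrite adj_sym.
have inD v : v \in R -> v \in D by apply: (subsetP RD).
have notN v : v \in R -> v \notin N by move/(subsetP RW)/setDP=> [].
have ltRD : #|R| < #|D|.
  apply: proper_card; apply/properP; split=> //; exists a.
    exact: (subsetP ND).
  by apply/negP=> /notN/negP.
have rR : rooted [set a] (N :\ a) R.
  split.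
  - by apply/set0Pn; exists u.
  - by rewrite disjoints1; apply/negP=> /notN/negP.
  - rewrite disjoint_sym disjoint_subset; apply/subsetP=> v /notN vN.
    by apply: contra vN => /setD1P[].
  - move=> v w vR Gvw; rewrite in_set1 in_setD1; case: eqP => //= _.
    case/orP: (nbrW v w (subsetP RW v vR) Gvw) => [->//|wW].
    by rewrite (Rc v w) ?orbT.
  - by move=> v _; apply: one_nbr_set1.
  - move=> v /inD vD; apply: leq_trans (one v vD).
    apply/subset_leq_card/subsetP=> w.
    by case/setIdP=> /setD1P[_ wN] Gw; apply/setIdP.
  - move=> K KR K0; apply: (rooted_exit1 rD) => //; first exact: subset_trans RD.
    by apply/negP=> /(subsetP KR)/notN/negP.
  - move=> K KR K0; have [v vK [Gav|[w /setDP[wR wK] Gvw]]] := Rex K KR K0.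
      apply/exitsP; exists v, a; split=> //; first by rewrite adj_sym.
        by apply/negP=> /(subsetP KR)/notN/negP.
      by rewrite !inE eqxx.
    apply/exitsP; exists v, w; split=> //.
    by apply/negP=> /setD1P[_]; apply/negP/notN.
  - by move=> K d KR; apply: rooted_exit1 rD _ _ (subset_trans KR RD).
  - by move=> v /inD; apply: rooted_deg rD _.
  by move=> v w /inD vD /inD wD; apply: rooted_sum rD _ _ vD wD.
have ext s : link [set a] (N :\ a) R s -> exists b, link A B D (a :: rcons s b).
  move=> [s0 us sR [c [b [/set1P-> /setD1P[ba bN] pab]]]].
  have /boundaryP[aD [x xA Gxa]] := aN.
  have : b \in boundary B D by rewrite eN.
  case/boundaryP=> bD [y yB Gyb]; exists b; split=> //.
  - rewrite cons_uniq rcons_uniq us mem_rcons inE negb_or eq_sym ba andbT /=.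
    by apply/andP; split; apply/negP=> /sR/notN/negP.
  - move=> z; rewrite inE mem_rcons inE.
    by case/or3P=> [/eqP->//|/eqP->//|/sR/inD].
  exists x, y; split=> //=.
  by rewrite Gxa rcons_path pab last_rcons adj_sym.
have [s [t [/ext[b ls] /ext[c lt] st]]] := IH _ _ _ ltRD rR.
by exists (a :: rcons s b), (a :: rcons t c); split=> //=; rewrite !size_rcons st.
Qed.

(** * The induction *)
Lemma two_links_or_one_boundary_nbr A B D : rooted A B D ->
    (forall A' B' D', #|D'| < #|D| -> rooted A' B' D' -> two_links A' B' D') ->
  two_links A B D \/
  (forall v, v \in D -> #|[set a in boundary A D | G v a]| <= 1).
Proof.
move=> rD IH; case: (boolP (unseparated A D)) => [tD|].
  case: (boolP [forall v in D, #|[set a in boundary A D | G v a]| <= 1]).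
    by move/forall_inP=> one; right.
  rewrite negb_forall_in => /exists_inP[v vD]; rewrite -ltnNge => /card_gt1P.
  have nbr c : c \in [set a in boundary A D | G v a] ->
    c \in boundary A D /\ G v c by rewrite inE => /andP[].
  case=> a [b [/nbr[aN Gva] /nbr[bN Gvb] ab]]; left.
  exact: (four_cycle_step rD tD vD aN bN ab Gva Gvb).
rewrite negb_forall_in => /exists_inP[v vD]; rewrite negb_forall.
case/existsP=> K; rewrite negb_imply => /andP[/andP[/andP[KD K0] vK] nex].
by left; apply: (separation_step rD IH vD KD K0 vK nex).
Qed.

Lemma rooted_two_links A B D : rooted A B D -> two_links A B D.
Proof.
have [n] := ubnP #|D|; elim: n A B D => // n IHn A B D ltDn rD.
have IH A' B' D' : #|D'| < #|D| -> rooted A' B' D' -> two_links A' B' D'.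
  by move=> ltD'D; apply: IHn; apply: leq_trans ltD'D ltDn.
have [//|oneA] := two_links_or_one_boundary_nbr rD IH.
have rD' := rooted_sym rD.
have [/two_links_sym//|oneB] := two_links_or_one_boundary_nbr rD' IH.
case: (boolP (boundary B D \subset boundary A D)) => [BA|]; last first.
  exact: contraction_step rD IH oneA.
case: (boolP (boundary A D \subset boundary B D)) => [AB|nAB]; last first.
  exact: two_links_sym (contraction_step rD' IH oneB nAB).
by apply: common_boundary_step => //; apply/eqP; rewrite eqEsubset BA.
Qed.

End RootedPieces.

(** * From 2-connected graphs to rooted pieces *)

(** Delete [d] and follow a path from [K] to [x] or to [y], whichever
    is still present.  It must leave [K], and the added edge cannot be used for
    that since its ends are outside [K]. *)
Lemma add_edge_exits (V : finType) (G : sgraph V) (x y d : V) (K : {set V}) :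
    x != y -> k_connected 2 (add_edge G x y) ->
    K \subset ~: [set x; y] -> K != set0 -> d \notin K -> exits G K [set d].
Proof.
move=> xy [_ conn] KD /set0Pn[k kK] dK; apply: contraT => nex.
have [_] := conn [set d] ltac:(by rewrite cards1).
pose z := if d == x then y else x.
have zd : z \in ~: [set d].
  rewrite !inE /z; case: (eqVneq d x) => [->|]; by rewrite eq_sym.
have zxy : z \in [set x; y] by rewrite /z !inE; case: ifP; rewrite eqxx ?orbT.
have kd : k \in ~: [set d] by rewrite !inE; apply: contraNneq dK => <-.
move/(_ k z kd zd).
set e := induced_rel _ _ => ekz.
have e_sym : symmetric e.
  by move=> u w; rewrite /e /induced_rel adj_sym andbCA.
have clK : closed e (mem K).
  apply: (intro_closed (sym_connect_sym e_sym)) => u w /and3P[_ wd] euw uK.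
  apply: contraR nex => wK; apply/exitsP; exists u, w; split=> //; last first.
    by rewrite !inE in wd *.
  case/orP: euw => // /andP[_ /eqP euw].
  by move/(subsetP KD): uK; rewrite inE -euw !inE eqxx.
have := closed_connect clK ekz; rewrite kK => /esym zK.
by move/(subsetP KD): zK; rewrite inE zxy.
Qed.

(** A link is nonempty, so each edge of the path it completes has an end
    other than [x] and [y]. *)
Lemma del_edge_path (V : finType) (G : sgraph V) (x y : V) (s : seq V) :
    x != y -> link G [set x] [set y] (~: [set x; y]) s ->
  is_path (del_edge G x y) x y (rcons s y).
Proof.
move=> xy [s0 us sD [a [b [/set1P-> /set1P-> pxy]]]].
have notin z : z \in [set x; y] -> z \notin s.
  by move=> zxy; apply/negP=> /sD; rewrite inE zxy.
split; last 1 first.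
- rewrite cons_uniq rcons_uniq us mem_rcons inE negb_or xy.
  by rewrite !notin ?inE ?eqxx ?orbT.
- have edge u w : (u \in s) || (w \in s) -> G u w -> del_edge G x y u w.
    move=> /orP uw Guw; rewrite /= /del_edge_rel Guw /=.
    apply/eqP=> euw; case: uw => /sD; rewrite inE -euw !inE eqxx ?orbT //.
  case: s s0 pxy edge {us sD notin} => // z s _ /= /andP[Gxz pzy] edge.
  rewrite edge ?inE ?eqxx ?orbT //=.
  have {Gxz} zs : z \in z :: s by rewrite mem_head.
  have ss : {subset s <= z :: s} by move=> w; rewrite inE orbC => ->.
  move: (z :: s) edge zs ss => r edge.
  elim: s z pzy => [|w s IHs] z /=; first by rewrite !andbT => Gzy zr _; rewrite edge ?zr.
  case/andP=> Gzw pw zr sr; rewrite edge ?zr //=; apply: IHs => //.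
    by apply: sr; rewrite mem_head.
  by move=> c cs; apply: sr; rewrite inE cs orbT.
by rewrite last_rcons.
Qed.

Theorem theorem5 (V : finType) (G : sgraph V) (x y : V) (hxy : x != y)
  (h2conn : k_connected 2 (add_edge G x y))
  (hdeg : forall v : V, v != x -> v != y -> 3 <= degree G v)
  (hsum : forall u v : V, G u v -> [set u; v] :&: [set x; y] = set0 ->
    7 <= degree G u + degree G v) :
  exists p q : seq V,
    [/\ is_path (del_edge G x y) x y p,
        is_path (del_edge G x y) x y q &
        size q = size p + 2].
Proof.
pose D := ~: [set x; y].
have exitD (K : {set V}) d : K \subset D -> K != set0 -> d \notin K -> exits G K [set d].
  exact: add_edge_exits.
have notD z : z \in [set x; y] -> forall K : {set V}, K \subset D -> z \notin K.
  by move=> zxy K KD; apply/negP=> /(subsetP KD); rewrite inE zxy.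
have rD : rooted G [set x] [set y] D.
  split=> //.
  - rewrite -card_gt0 cardsCs setCK cards2 hxy subn_gt0.
    by case: h2conn.
  - by rewrite disjoints1 !inE eqxx.
  - by rewrite disjoints1 !inE eqxx orbT.
  - by move=> v w _ _; rewrite !inE orbA orbN.
  - by move=> v _; apply: one_nbr_set1.
  - by move=> v _; apply: one_nbr_set1.
  - by move=> K KD K0; apply: exitD => //; apply: notD KD; rewrite !inE eqxx.
  - by move=> K KD K0; apply: exitD => //; apply: notD KD; rewrite !inE eqxx orbT.
  - by move=> v; rewrite !inE negb_or => /andP[]; apply: hdeg.
  move=> u v uD vD Guv; apply: hsum => //; apply/setP=> z; rewrite !inE.
  apply/negbTE/negP=> /andP[/orP[] /eqP-> zxy].
    by move: uD; rewrite !inE zxy.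
  by move: vD; rewrite !inE zxy.
have [s [t [ls lt st]]] := rooted_two_links rD.
exists (rcons s y), (rcons t y); split; try exact: del_edge_path.
by rewrite !size_rcons st.
Qed.
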